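(* For any $\mu\in\mathcal D$, the reduced basis approximation $u_N(\mu)$ of the discrete solution $u_h(\mu)$ satisfies $$\|u_h(\mu)-u_N(\mu)\|_{\mathcal X_h}\le\eta_N^M(\mu)\le C_e(\mu)\,\|u_h(\mu)-u_N(\mu)\|_{\mathcal X_h}$$ for some constant $C_e(\mu)>0$.
   Context: $\Omega\subset\mathbb R^P$, $P\in\{1,2,3\}$, is a bounded Lipschitz domain, $\mathcal D\subset\mathbb R^d$ a tensor-product parameter domain, and $V\hookrightarrow H\hookrightarrow V'$ a Gelfand triple of Hilbert spaces of functions on $\Omega$ with dense embedding. For $\mu\in\mathcal D$, $a(\cdot,\cdot;\mu)$ is a uniformly continuous and coercive bilinear form on $V$, $f(\cdot;\mu)\in V'$ is bounded uniformly in $\mu$, $g\in C^0(0,T]$, and $u_0(\mu)=\sum_{q=1}^{Q_0}\theta_0^q(\mu)u_q\in H$ with $u_q\in H$ independent of $\mu$. $V_h\subset V$ is a finite element space, $\Delta t=T/M$, $t^m=m\Delta t$, $\delta w^m=(w^m-w^{m-1})/\Delta t$. For $w\in V_h$, $\|w\|_{V_h'}=\sup_{v\in V_h}(w,v)_H/\|v\|_V$. The space $\mathcal X_h=\{(w^m)_{m=0}^M:w^m\in V_h\}$ is normed by $$\|w\|_{\mathcal X_h}^2=\sum_{m=1}^M\Delta t\|\delta w^m\|_{V_h'}^2+\sum_{m=1}^M\Delta t\|w^m\|_V^2+\sum_{m=1}^M\Delta t^2\|\delta w^m\|_H^2+\|w^M\|_H^2.$$ Discrete solution: $u_h(\mu)\in\mathcal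 X_h$ satisfies $(\delta u_h^m(\mu),v_h)_H+a(u_h^m(\mu),v_h;\mu)=g(t^m)f(v_h;\mu)$ for all $v_h\in V_h$, $1\le m\le M$, and $(u_h^0(\mu),v_h)_H=(u_0(\mu),v_h)_H$ for all $v_h\in V_h$. Reduced basis solution: $V_N\subset V_h$ is the reduced space, a linear subspace that by construction contains the $H$-orthogonal projections onto $V_h$ of $u_1,\dots,u_{Q_0}$, so that the discrete initial condition is represented exactly. $u_N(\mu)=(u_N^m(\mu))_{m=0}^M$, $u_N^m(\mu)\in V_N$, satisfies $(\delta u_N^m(\mu),v_N)_H+a(u_N^m(\mu),v_N;\mu)=g(t^m)f(v_N;\mu)$ for all $v_N\in V_N$, $1\le m\le M$, and $(u_N^0(\mu),v_N)_H=(u_0(\mu),v_N)_H$ for all $v_N\in V_N$. Constants: $\alpha_h(\mu)=\inf_{v\in V_h}a(v,v;\mu)/\|v\|_V^2$, $\gamma_h(\mu)=\sup_{w,v\in V_h}a(w,v;\mu)/(\|w\|_V\|v\|_V)$; there are bounds $\alpha_h(\mu)\ge\alpha_{LB}(\mu)\ge\underline\alpha>0$ and $\gamma_h(\mu)\le\gamma_{UB}(\mu)\le\overline\gamma<\infty$ for all $\mu\in\mathcal D$, and $$\beta_{LB}(\mu)=\frac{\min(\alpha_{LB}(\mu)/\gamma_{UB}(\mu)^2,\ \alpha_{LB}(\mu),\ 1)}{\sqrt{2\max(1/\alpha_{LB}(\mu)^2,1)+1}}>0.$$ Estimator: the residual is $r_N^m(v_h;\mu)=g(t^m)f(v_h;\mu)-(\delta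 u_N^m(\mu),v_h)_H-a(u_N^m(\mu),v_h;\mu)$, $v_h\in V_h$; $R_N^m(\mu)\in V_h$ is its Riesz representer with respect to $(\cdot,\cdot)_V$, so $\|R_N^m(\mu)\|_V=\sup_{v_h\in V_h}|r_N^m(v_h;\mu)|/\|v_h\|_V$; and $$\eta_N^M(\mu)=\Big(\frac{\Delta t}{\beta_{LB}(\mu)^2}\sum_{m=1}^M\|R_N^m(\mu)\|_V^2\Big)^{1/2}.$$ Suprema and infima are over nonzero elements. *)

(* Defs.v *)
From HB Require Import structures.
From mathcomp Require Export all_boot all_order all_algebra.
From mathcomp Require Export all_classical all_reals all_analysis.
From mathcomp Require Export sesquilinear.
Export Order.TTheory GRing.Theory Num.Theory.
Export numFieldNormedType.Exports.

Set Implicit Arguments.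
Unset Strict Implicit.
Unset Printing Implicit Defensive.

#[export] Set Implicit Arguments.
#[export] Unset Strict Implicit.
#[export] Unset Printing Implicit Defensive.

Local Open Scope classical_set_scope.
Local Open Scope ring_scope.

Definition eucl_dist (R : realType) (n : nat) (x y : 'rV[R]_n) : R :=
  Num.sqrt (\sum_(i < n) (x 0 i - y 0 i) ^+ 2).

(* Near each boundary point, Omega lies, in suitable
   orthonormal coordinates (given by O), on one side of the graph of a Lipschitz
   function of the last p coordinates.  When p = 0 such a function is a
   constant and Omega is a bounded open interval. *)
Record bounded_lipschitz_domain (R : realType) (p : nat)
    (Omega : set 'rV[R]_p.+1) : Prop := BoundedLipschitzDomain {
  bld_nonempty : Omega !=set0 ;
  bld_open : open Omega ;
  bld_connected : connected Omega ;
  bld_bounded : bounded_set Omega ;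
  bld_boundary : forall x, (closure Omega `\` interior Omega) x ->
    exists r : R, exists O : 'M[R]_p.+1, exists phi : 'rV[R]_p -> R,
    exists L : R,
    [/\ 0 < r,
        O *m O^T = 1%:M,
        forall s t, `|phi s - phi t| <= L * eucl_dist s t
      & forall y, eucl_dist x y < r ->
          (Omega y <-> phi (col' 0 (y *m O)) < (y *m O) 0 0)] }.

(* Sets of Lebesgue measure zero in R^P, by coverings with countably many
   boxes of arbitrarily small total volume. *)
Definition null_set (R : realType) (P : nat) (A : set 'rV[R]_P) : Prop :=
  forall e : R, 0 < e -> exists a b : nat -> 'rV[R]_P,
    [/\ forall k i, a k 0 i <= b k 0 i,
        A `<=` \bigcup_k [set x | forall i, a k 0 i <= x 0 i <= b k 0 i]
      & forall n, \sum_(k < n) \prod_i (b k 0 i - a k 0 i) <= e].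

Definition ae_on (R : realType) (P : nat) (Omega : set 'rV[R]_P)
    (Q : 'rV[R]_P -> Prop) : Prop :=
  null_set [set x | Omega x /\ ~ Q x].

(* The elements of H are functions on Omega, identified when they agree almost
   everywhere; rep picks a representative of each element. *)
Record space_of_functions (R : realType) (P : nat) (Omega : set 'rV[R]_P)
    (H : lmodType R) (rep : H -> 'rV[R]_P -> R) : Prop := SpaceOfFunctions {
  sof_linear : forall (c : R) (u v : H),
    ae_on Omega (fun x => rep (c *: u + v) x = c * rep u x + rep v x) ;
  sof_inj : forall u : H, ae_on Omega (fun x => rep u x = 0) -> u = 0 }.

(* A Hilbert space is a complete normed module whose norm comes from an inner
   product. *)
Definition norm_from_dot (R : realType) (E : completeNormedModType R)
    (ip : {dot E for idfun}) : Prop :=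
  forall x : E, `|x| ^+ 2 = ip x x.

(* V is embedded in H by j, and H in V' by w |-> (w, j _)_H, H being identified
   with its dual. *)
Record gelfand_triple (R : realType) (V H : completeNormedModType R)
    (ipV : {dot V for idfun}) (ipH : {dot H for idfun})
    (j : {linear V -> H}) : Prop := GelfandTriple {
  gt_hilbertV : norm_from_dot ipV ;
  gt_hilbertH : norm_from_dot ipH ;
  gt_inj : injective j ;
  gt_continuous : continuous j ;
  gt_dense : dense (range j) }.

Definition tensor_product_domain (R : realType) (d : nat)
    (D : set 'rV[R]_d) : Prop :=
  exists D1 : 'I_d -> set R, D = [set mu | forall i, D1 i (mu 0 i)].

Definition unif_continuous_form (R : realType) (d : nat) (D : set 'rV[R]_d)
    (V : normedModType R) (a : 'rV[R]_d -> {biscalar V}) : Prop :=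
  exists C : R, forall mu, D mu -> forall w v : V,
    `|a mu w v| <= C * `|w| * `|v|.

Definition unif_coercive_form (R : realType) (d : nat) (D : set 'rV[R]_d)
    (V : normedModType R) (a : 'rV[R]_d -> {biscalar V}) : Prop :=
  exists2 c : R, 0 < c & forall mu, D mu -> forall v : V,
    c * `|v| ^+ 2 <= a mu v v.

Definition unif_bounded_functional (R : realType) (d : nat) (D : set 'rV[R]_d)
    (V : normedModType R) (f : 'rV[R]_d -> {scalar V}) : Prop :=
  exists C : R, forall mu, D mu -> forall v : V, `|f mu v| <= C * `|v|.

Definition linear_subspace (R : realType) (E : lmodType R) (S : set E) : Prop :=
  S 0 /\ forall (c : R) (x y : E), S x -> S y -> S (c *: x + y).

Definition findim_subspace (R : realType) (E : lmodType R) (S : set E) : Prop :=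
  exists (n : nat) (b : 'I_n -> E),
    S = [set \sum_i c i *: b i | c in [set: 'I_n -> R]].

Definition nonzero (R : realType) (E : lmodType R) (S : set E) : set E :=
  [set v | S v /\ v <> 0].

Section Discretization.
Variables (R : realType) (V H : completeNormedModType R).
Variables (ipV : {dot V for idfun}) (ipH : {dot H for idfun}).
Variables (j : {linear V -> H}) (Vh : set V).

Definition is_H_projection (u : H) (p : V) : Prop :=
  Vh p /\ forall v, Vh v -> ipH (j p) (j v) = ipH u (j v).

Definition dual_norm (w : V) : R :=
  sup [set ipH (j w) (j v) / `|v| | v in nonzero Vh].

Definition alpha_h (b : {biscalar V}) : R :=
  inf [set b v v / `|v| ^+ 2 | v in nonzero Vh].

Definition gamma_h (b : {biscalar V}) : R :=
  sup [set b w v / (`|w| * `|v|) | w in nonzero Vh & v in nonzero Vh].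

(* Only the values w 0, .., w M of a discrete trajectory w : nat -> V matter. *)
Variables (dt : R) (M : nat).

Definition delta (w : nat -> V) (m : nat) : V := dt^-1 *: (w m - w m.-1).

Definition Xnorm (w : nat -> V) : R :=
  Num.sqrt (\sum_(1 <= m < M.+1) dt * dual_norm (delta w m) ^+ 2
          + \sum_(1 <= m < M.+1) dt * `|w m| ^+ 2
          + \sum_(1 <= m < M.+1) dt ^+ 2 * `|j (delta w m)| ^+ 2
          + `|j (w M)| ^+ 2).

(* For S = Vh this is the discrete solution, for S = VN the reduced one. *)
Definition galerkin_solution (S : set V) (b : {biscalar V}) (l : {scalar V})
    (g : R -> R) (u0 : H) (w : nat -> V) : Prop :=
  [/\ forall m, (m <= M)%N -> S (w m),
      forall m, (1 <= m <= M)%N -> forall v, S v ->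
        ipH (j (delta w m)) (j v) + b (w m) v = g (m%:R * dt) * l v
    & forall v, S v -> ipH (j (w 0)) (j v) = ipH u0 (j v)].

Definition residual (b : {biscalar V}) (l : {scalar V}) (g : R -> R)
    (w : nat -> V) (m : nat) (v : V) : R :=
  g (m%:R * dt) * l v - ipH (j (delta w m)) (j v) - b (w m) v.

Definition is_residual_representer (b : {biscalar V}) (l : {scalar V})
    (g : R -> R) (w : nat -> V) (Rm : nat -> V) : Prop :=
  forall m, (1 <= m <= M)%N ->
    Vh (Rm m) /\ forall v, Vh v -> ipV (Rm m) v = residual b l g w m v.

Definition estimator (beta : R) (Rm : nat -> V) : R :=
  Num.sqrt (dt / beta ^+ 2 * \sum_(1 <= m < M.+1) `|Rm m| ^+ 2).

End Discretization.

Definition beta_LB (R : realType) (alpha gamma : R) : R :=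
  Num.min (Num.min (alpha / gamma ^+ 2) alpha) 1
    / Num.sqrt (2 * Num.max (1 / alpha ^+ 2) 1 + 1).

(* Main.v *)
Require Import Defs.
From mathcomp Require Import ring lra.
(** The error e = u_h - u_N vanishes at m = 0 and satisfies, on V_h,
    (delta e^m, v)_H + a(e^m, v) = (R^m, v)_V.  Choose z^m in V_h with
    a(v, z^m) = (delta e^m, v)_H for all v, and test with z^m + e^m: the left
    side becomes a(z^m, z^m) + 2 (delta e^m, e^m)_H + a(e^m, e^m), where
    ||z^m||_V is comparable to the dual norm of delta e^m, and
    2 dt (delta e^m, e^m)_H telescopes up to dt^2 ||delta e^m||_H^2.  Young's
    inequality, weighted so as to produce beta_LB, and summation over m bound
    the error by the estimator.  The converse bound follows by testing with
    R^m. *)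

Local Open Scope classical_set_scope.
Local Open Scope ring_scope.

(** * Inner products: polarization and the Cauchy-Schwarz inequality *)

Section InnerProduct.
Variables (R : realType) (E : completeNormedModType R) (ip : {dot E for idfun}).

Lemma dotC u v : ip u v = ip v u.
Proof. by rewrite hermC expr0 mul1r. Qed.

Lemma dotZr c u v : ip u (c *: v) = c * ip u v.
Proof. exact: linearZr_LR. Qed.

Lemma dotZl c u v : ip (c *: u) v = c * ip u v.
Proof. exact: linearZl_LR. Qed.

Hypothesis ip_norm : norm_from_dot ip.

Lemma sqr_normDot u v : `|u + v| ^+ 2 = `|u| ^+ 2 + `|v| ^+ 2 + 2 * ip u v.
Proof.
by rewrite !ip_norm linearDl !linearDr /= (dotC v u); ring.
Qed.

Lemma sqr_normBot u v : `|u - v| ^+ 2 = `|u| ^+ 2 + `|v| ^+ 2 - 2 * ip u v.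
Proof. by rewrite sqr_normDot normrN linearNr /=; ring. Qed.

Lemma dot_le_norm u v : ip u v <= `|u| * `|v|.
Proof.
have [->|u0] := eqVneq u 0; first by rewrite linear0l normr0 mul0r.
have [->|v0] := eqVneq v 0; first by rewrite linear0r normr0 mulr0.
have uv0 : 0 < `|u| * `|v| by rewrite mulr_gt0 ?normr_gt0.
(* This square expands to [2 |u| |v| (|u| |v| - ip u v)]. *)
have := sqr_ge0 `| `|v| *: u - `|u| *: v |.
rewrite sqr_normBot !normrZ !normr_id dotZl dotZr => h.
rewrite -(ler_pM2l uv0); nra.
Qed.

End InnerProduct.

(** * Linear subspaces and finite-dimensional variational problems *)

Lemma findim_linear_subspace (R : realType) (E : lmodType R) (S : set E) :
  findim_subspace S -> linear_subspace S.
Proof.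
move=> [n [b ->]]; split.
  by exists (fun=> 0) => //; rewrite big1// => i _; rewrite scale0r.
move=> c _ _ [x _ <-] [y _ <-]; exists (fun i => c * x i + y i) => //.
rewrite scaler_sumr -big_split/=; apply: eq_bigr => i _.
by rewrite scalerA scalerDl.
Qed.

Section LinearSubspace.
Variables (R : realType) (E : lmodType R) (S : set E).
Hypothesis hS : linear_subspace S.

Lemma linear_subspaceZ c x : S x -> S (c *: x).
Proof.
by move=> Sx; rewrite -[_ *: _]addr0; apply: hS.2 => //; exact: hS.1.
Qed.

Lemma linear_subspaceD x y : S x -> S y -> S (x + y).
Proof. by move=> Sx Sy; rewrite -[x]scale1r; exact: hS.2. Qed.

Lemma linear_subspaceB x y : S x -> S y -> S (x - y).
Proof.
by move=> Sx Sy; rewrite addrC -scaleN1r; exact: hS.2.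
Qed.

Lemma linear_subspace_sum n (c : 'I_n -> R) (x : 'I_n -> E) :
  (forall i, S (x i)) -> S (\sum_i c i *: x i).
Proof.
move=> Sx; apply: (big_ind S) => [|y z|i _]; first exact: hS.1.
- exact: linear_subspaceD.
- exact: linear_subspaceZ.
Qed.

End LinearSubspace.

(** Finite-dimensional Lax-Milgram for a form that need not be symmetric. The unknown is the second
    argument because the supremizer below solves an adjoint problem. *)
Lemma definite_form_solvable (R : realType) (E : lmodType R) (S : set E)
    (b : {biscalar E}) (l : {scalar E}) :
  findim_subspace S -> (forall v, S v -> b v v = 0 -> v = 0) ->
  exists2 z, S z & forall v, S v -> b v z = l v.
Proof.
move=> [n [x SE]] bdef.
(* If c is killed by the transposed system, y = \sum_i c_i x_i satisfies
   b y y = 0, hence y = 0 and l y = 0: the system is consistent even when the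
   x_i are linearly dependent. *)
pose G : 'M[R]_n := \matrix_(k, i) b (x i) (x k).
pose L : 'rV[R]_n := \row_i l (x i).
have : (L <= G)%MS.
  rewrite submxE; apply/eqP/matrixP => i0 k; rewrite ord1 {i0}.
  pose c i := cokermx G i k; pose y := \sum_i c i *: x i.
  have Gc : G *m cokermx G = 0 by rewrite mulmx_coker.
  have yx m : b y (x m) = 0.
    move/matrixP/(_ m k): Gc; rewrite !mxE => <-.
    rewrite /y linear_sumlz; apply: eq_bigr => i _.
    by rewrite linearZl_LR mxE mulrC.
  have y0 : y = 0.
    apply: bdef; first by rewrite SE; exists c.
    rewrite {2}/y linear_sumr big1// => i _.
    by rewrite linearZr_LR/= yx mulr0.
  transitivity (l y); last by rewrite y0 linear0 mxE.
  rewrite /y linear_sum mxE; apply: eq_bigr => i _.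
  by rewrite linearZ/= mxE mulrC.
move=> /submxP[d Ld].
exists (\sum_k d 0 k *: x k); first by rewrite SE; exists (d 0).
move=> v; rewrite SE => -[c _ <-].
rewrite linear_sumlz linear_sum; apply: eq_bigr => i _.
rewrite linearZl_LR linearZ/=; congr (_ * _).
move/matrixP/(_ 0 i): Ld; rewrite !mxE => ->.
rewrite linear_sumr; apply: eq_bigr => k _.
by rewrite linearZr_LR mxE.
Qed.

(** * Coercivity and continuity constants, dual norm on [Vh] *)

Lemma continuous_linear_norm_le (R : realType) (V W : normedModType R)
    (f : {linear V -> W}) :
  continuous f -> exists2 C : R, 0 < C & forall v, `|f v| <= C * `|v|.
Proof.
by move=> /linear_bounded_continuous/linear_boundedP/pinfty_ex_gt0[C C0 fC];
  exists C.
Qed.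

Section DiscreteNorms.
Variables (R : realType) (V H : completeNormedModType R).
Variables (ipH : {dot H for idfun}) (j : {linear V -> H}) (Vh : set V).
Hypothesis hVh : linear_subspace Vh.

Section Forms.
Variable b : {biscalar V}.

(** The constant [C] bounds the Rayleigh quotients from below, so that their [inf] is a true infimum
    and not a default value. *)
Lemma alpha_h_le (C : R) v : (forall u, C * `|u| ^+ 2 <= b u u) ->
  Vh v -> alpha_h Vh b * `|v| ^+ 2 <= b v v.
Proof.
move=> bC Vv; have [->|v0] := eqVneq v 0.
  by rewrite normr0 expr0n/= mulr0 linear0l.
rewrite -ler_pdivlMr ?exprn_gt0 ?normr_gt0//; apply: ge_inf.
  exists C => _ [u [_ /eqP u0] <-].
  by rewrite ler_pdivlMr ?exprn_gt0 ?normr_gt0.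
by exists v => //; split => //; exact/eqP.
Qed.

Lemma le_gamma_h (C : R) w v : (forall u v, `|b u v| <= C * `|u| * `|v|) ->
  Vh w -> Vh v -> b w v <= gamma_h Vh b * `|w| * `|v|.
Proof.
move=> bC Vw Vv; have [->|w0] := eqVneq w 0.
  by rewrite normr0 mulr0 mul0r linear0l.
have [->|v0] := eqVneq v 0; first by rewrite normr0 mulr0 linear0r.
rewrite -mulrA -ler_pdivrMr ?mulr_gt0 ?normr_gt0//; apply: ub_le_sup.
  exists C => _ [u [_ /eqP u0] [u' [_ /eqP u'0] <-]].
  rewrite ler_pdivrMr ?mulr_gt0 ?normr_gt0// mulrA.
  exact: le_trans (ler_norm _) (bC _ _).
exists w; first by split => //; exact/eqP.
by exists v => //; split => //; exact/eqP.
Qed.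

End Forms.

Section DualNorm.
Hypotheses (ipH_norm : norm_from_dot ipH) (j_cont : continuous j).
Hypothesis Vh_neq0 : nonzero Vh !=set0.

Lemma le_dual_norm w v : Vh v ->
  ipH (j w) (j v) <= dual_norm ipH j Vh w * `|v|.
Proof.
move=> Vv; have [->|v0] := eqVneq v 0.
  by rewrite normr0 mulr0 linear0 linear0r.
have [C C0 jC] := continuous_linear_norm_le j_cont.
rewrite -ler_pdivrMr ?normr_gt0//; apply: ub_le_sup.
  exists (`|j w| * C) => _ [u [_ /eqP u0] <-].
  rewrite ler_pdivrMr ?normr_gt0// -mulrA.
  exact: le_trans (dot_le_norm ipH_norm _ _) (ler_wpM2l (normr_ge0 _) (jC _)).
by exists v => //; split => //; exact/eqP.
Qed.

(** The supremum carries no absolute value; testing with both [v] and [-v] and adding gives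
    [0 <= 2 * dual_norm w * |v|]. *)
Lemma dual_norm_ge0 w : 0 <= dual_norm ipH j Vh w.
Proof.
have [v [Vv /eqP v0]] := Vh_neq0.
have h1 := le_dual_norm w Vv.
have := le_dual_norm w (linear_subspaceZ hVh (-1) Vv).
rewrite scaleN1r linearN linearNr /= normrN => h2.
rewrite -(pmulr_lge0 _ (_ : 0 < `|v|)) ?normr_gt0//; lra.
Qed.

Lemma dual_norm_le w C : (forall v, Vh v -> ipH (j w) (j v) <= C * `|v|) ->
  dual_norm ipH j Vh w <= C.
Proof.
move=> wC; apply: ge_sup.
  by have [v Vv] := Vh_neq0; exists (ipH (j w) (j v) / `|v|), v.
move=> _ [v [Vv /eqP v0] <-].
by rewrite ler_pdivrMr ?normr_gt0//; exact: wC.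
Qed.

End DualNorm.

End DiscreteNorms.

(** * Error and residual on a single time step *)

Section ErrorStep.
Variables (R : realType) (V H : completeNormedModType R).
Variables (ipV : {dot V for idfun}) (ipH : {dot H for idfun}).
Variables (j : {linear V -> H}) (Vh : set V) (b : {biscalar V}) (al ga dt : R).
Hypotheses (ipV_norm : norm_from_dot ipV) (ipH_norm : norm_from_dot ipH).
Hypotheses (j_cont : continuous j) (hVh : findim_subspace Vh).
Hypothesis Vh_neq0 : nonzero Vh !=set0.
Hypotheses (al_gt0 : 0 < al) (ga_gt0 : 0 < ga).
Hypothesis b_coer : forall v, Vh v -> al * `|v| ^+ 2 <= b v v.
Hypothesis b_cont : forall w v, Vh w -> Vh v -> b w v <= ga * `|w| * `|v|.
Hypothesis dt_gt0 : 0 < dt.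

Let dn := dual_norm ipH j Vh.
Let Vl := findim_linear_subspace hVh.

(** Continuity of [b] bounds the functional [b v z] by [ga |z| |v|]; testing with [v = z] and
    coercivity give the reverse comparison. *)
Lemma riesz_supremizer (D : V) : exists z,
  [/\ Vh z, forall v, Vh v -> b v z = ipH (j D) (j v),
      dn D <= ga * `|z| & al * `|z| <= dn D].
Proof.
pose l : {scalar V} := (ipH (j D) : {scalar H}) \o j.
have [v Vv v0|z Vz bl] := definite_form_solvable l hVh (b := b).
  have := b_coer Vv; rewrite v0 pmulr_rle0// => v2.
  by apply/eqP; rewrite -normr_eq0 -sqrf_eq0 eq_le v2 sqr_ge0.
have bz v : Vh v -> b v z = ipH (j D) (j v) by exact: bl.
exists z; split => //.
  by apply: dual_norm_le => // v Vv; rewrite -bz// mulrAC; exact: b_cont.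
have [->|z0] := eqVneq z 0.
  by rewrite normr0 mulr0; exact: dual_norm_ge0.
rewrite -(ler_pM2r (_ : 0 < `|z|)) ?normr_gt0// -mulrA -expr2.
by rewrite (le_trans (b_coer Vz))// bz//; exact: le_dual_norm.
Qed.

(** [ka] and [K] are the numerator and the radicand of [beta_LB], so
    [beta_LB ^+ 2 = ka ^+ 2 / K]. *)
Let ka := Num.min (Num.min (al / ga ^+ 2) al) 1.
Let K := 2 * Num.max (1 / al ^+ 2) 1 + 1.

Lemma error_step_le e e' r : let D := dt^-1 *: (e - e') in
  Vh e -> (forall v, Vh v -> ipV r v = ipH (j D) (j v) + b e v) ->
  ka ^+ 2 * (dt * dn D ^+ 2 + dt * `|e| ^+ 2)
    + 2 * ka * (dt ^+ 2 * `|j D| ^+ 2 + `|j e| ^+ 2 - `|j e'| ^+ 2)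
  <= K * (dt * `|r| ^+ 2).
Proof.
move=> D Ve rE.
have ka_gt0 : 0 < ka by rewrite !lt_min al_gt0 ltr01 divr_gt0 ?exprn_gt0.
have ka_al : ka <= al by rewrite !ge_min lexx orbT.
have ka_alga : ka * ga ^+ 2 <= al.
  by rewrite -ler_pdivlMr ?exprn_gt0// !ge_min lexx.
have max_ge1 : 1 <= Num.max (1 / al ^+ 2) 1 by rewrite le_max lexx orbT.
have max_al : 1 <= Num.max (1 / al ^+ 2) 1 * al ^+ 2.
  by rewrite -ler_pdivrMr ?exprn_gt0// le_max lexx.
have [z [Vz bz Nz zN]] := riesz_supremizer D.
have N0 : 0 <= dn D by exact: dual_norm_ge0.
have [al_ge0 ga_ge0] := (ltW al_gt0, ltW ga_gt0).
have Nz2 : dn D ^+ 2 <= ga ^+ 2 * `|z| ^+ 2.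
  by rewrite -exprMn lerXn2r ?nnegrE ?mulr_ge0.
have zN2 : al ^+ 2 * `|z| ^+ 2 <= dn D ^+ 2.
  by rewrite -exprMn lerXn2r ?nnegrE ?mulr_ge0.
(* By the choice of [z], the right side is [b z z + b e e + 2 (D, e)_H]. The first entry of the
   minimum [ka] handles [b z z], the second [b e e]. *)
have lower : ka * dn D ^+ 2 + ka * `|e| ^+ 2 + 2 * ipH (j D) (j e)
    <= ipV r (z + e).
  rewrite linearDr/= !rE// -bz// (bz e)//.
  have := b_coer Vz; have := b_coer Ve.
  have := ler_wpM2r (sqr_ge0 `|e|) ka_al.
  have := ler_wpM2r (sqr_ge0 `|z|) ka_alga.
  have := ler_wpM2l (ltW ka_gt0) Nz2.
  lra.
(* The factor 2 in [K] comes from [|z + e|^2 <= 2 |z|^2 + 2 |e|^2], the maximum from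
   [|z| <= dn D / al]. *)
have upper : `|z + e| ^+ 2 <= K * (dn D ^+ 2 + `|e| ^+ 2).
  have : `|z + e| ^+ 2 <= 2 * `|z| ^+ 2 + 2 * `|e| ^+ 2.
    have := sqr_ge0 `|z - e|.
    by rewrite (sqr_normBot ipV_norm) (sqr_normDot ipV_norm); lra.
  have z2 : `|z| ^+ 2 <= Num.max (1 / al ^+ 2) 1 * dn D ^+ 2.
    apply: (le_trans (ler_peMl (sqr_ge0 _) max_al)).
    by rewrite -mulrA ler_wpM2l// (le_trans ler01).
  have e2 := ler_wpM2r (sqr_ge0 `|e|) max_ge1.
  by rewrite /K; have := sqr_ge0 (dn D); have := sqr_ge0 `|e|; lra.
have K_gt0 : 0 < K by rewrite /K; lra.
(* Young's inequality with weight [K]; by [upper], the term [ka^2 / K |z + e|^2] loses its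
   denominator. *)
have young : 2 * ka * ipV r (z + e)
    <= K * `|r| ^+ 2 + ka ^+ 2 * (dn D ^+ 2 + `|e| ^+ 2).
  rewrite -(ler_pM2l K_gt0).
  have := sqr_ge0 `|K *: r - ka *: (z + e)|.
  rewrite (sqr_normBot ipV_norm) dotZl dotZr !normrZ !exprMn.
  rewrite !real_normK ?num_real//.
  have := ler_wpM2l (sqr_ge0 ka) upper.
  lra.
(* Substituting [e' = e - dt D] exposes the numerical dissipation of backward Euler. *)
have polar : dt ^+ 2 * `|j D| ^+ 2 + `|j e| ^+ 2 - `|j e'| ^+ 2
    = 2 * dt * ipH (j D) (j e).
  have -> : j e' = j e - dt *: j D.
    rewrite -linearZ -linearB; congr (j _).
    by rewrite /D scalerA divff ?gt_eqF// scale1r opprB addrC subrK.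
  rewrite (sqr_normBot ipH_norm) normrZ exprMn.
  by rewrite real_normK ?num_real// dotZr (dotC _ (j e)); ring.
rewrite polar.
(* Twice [lower], scaled by [dt ka], yields [2 ka^2] times the norm terms; [young] absorbs half of
   them. *)
have := ler_wpM2l (ltW dt_gt0) young.
have := ler_wpM2l (ltW (mulr_gt0 dt_gt0 ka_gt0)) lower.
lra.
Qed.

Lemma residual_step_le D e r : Vh e -> Vh r ->
  (forall v, Vh v -> ipV r v = ipH (j D) (j v) + b e v) ->
  `|r| ^+ 2 <= 2 * (1 + ga ^+ 2) * (dn D ^+ 2 + `|e| ^+ 2).
Proof.
move=> Ve Vr rE.
have N0 : 0 <= dn D by exact: dual_norm_ge0.
have : `|r| <= dn D + ga * `|e|.
  have [->|r0] := eqVneq r 0.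
    by rewrite normr0 addr_ge0// mulr_ge0// ltW.
  rewrite -(ler_pM2r (_ : 0 < `|r|)) ?normr_gt0// -expr2 ipV_norm rE// mulrDl.
  by apply: lerD; [exact: le_dual_norm|exact: b_cont].
rewrite -(ler_pXn2r (_ : 0 < 2)%N) ?nnegrE ?addr_ge0 ?mulr_ge0//
  ?(ltW ga_gt0)//.
move=> /le_trans; apply.
(* [(x + y)^2 <= 2 x^2 + 2 y^2], then the missing cross terms [|e|^2] and [(ga dn D)^2] are
   added. *)
have := sqr_ge0 (dn D - ga * `|e|); have := sqr_ge0 `|e|.
have := sqr_ge0 (ga * dn D).
rewrite !exprMn; nra.
Qed.

(** * Summation over the time steps *)

Section Trajectory.
Variables (M : nat) (e r : nat -> V).
Hypothesis e0 : j (e 0) = 0.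
Hypothesis Vhe : forall m, (1 <= m <= M)%N -> Vh (e m).
Hypothesis Vhr : forall m, (1 <= m <= M)%N -> Vh (r m).
Hypothesis rE : forall m, (1 <= m <= M)%N -> forall v, Vh v ->
  ipV (r m) v = ipH (j (delta dt e m)) (j v) + b (e m) v.

Let sq := \sum_(1 <= m < M.+1) `|r m| ^+ 2.

Lemma Xnorm_sq : Xnorm ipH j Vh dt M e ^+ 2 =
  \sum_(1 <= m < M.+1) (dt * dn (delta dt e m) ^+ 2 + dt * `|e m| ^+ 2)
  + \sum_(1 <= m < M.+1) dt ^+ 2 * `|j (delta dt e m)| ^+ 2 + `|j (e M)| ^+ 2.
Proof.
rewrite sqr_sqrtr ?big_split//.
by rewrite !addr_ge0 ?sqr_ge0// sumr_ge0// => m _;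
  rewrite mulr_ge0 ?sqr_ge0// ltW.
Qed.

Lemma Xnorm_le_residual :
  ka ^+ 2 * Xnorm ipH j Vh dt M e ^+ 2 <= K * (dt * sq).
Proof.
have ka_gt0 : 0 < ka by rewrite !lt_min al_gt0 ltr01 divr_gt0 ?exprn_gt0.
have ka_le1 : ka <= 1 by rewrite !ge_min lexx orbT.
have step : \sum_(1 <= m < M.+1)
    (ka ^+ 2 * (dt * dn (delta dt e m) ^+ 2 + dt * `|e m| ^+ 2)
     + (2 * ka * (dt ^+ 2 * `|j (delta dt e m)| ^+ 2)
        + 2 * ka * (`|j (e m)| ^+ 2 - `|j (e m.-1)| ^+ 2)))
    <= \sum_(1 <= m < M.+1) K * (dt * `|r m| ^+ 2).
  rewrite big_nat [leRHS]big_nat; apply: ler_sum => m mM.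
  rewrite -[X in _ + X]mulrDr [X in _ + _ * X]addrA.
  exact: (error_step_le (e' := e m.-1) (Vhe mM) (rE mM)).
(* The lower end of the telescoping sum vanishes by [e0]. *)
have tele : \sum_(1 <= m < M.+1) (`|j (e m)| ^+ 2 - `|j (e m.-1)| ^+ 2)
    = `|j (e M)| ^+ 2.
  rewrite big_add1 (telescope_sumr (fun m => `|j (e m)| ^+ 2))//=.
  by rewrite e0 normr0 expr0n/= subr0.
move: step; rewrite !big_split/= -!mulr_sumr tele -/sq Xnorm_sq => step.
(* Jump terms and final value carry the factor [2 ka], which exceeds [ka^2] since [ka <= 1]: this is
   the role of the entry 1 in the minimum. *)
apply: le_trans step; rewrite -addrA mulrDr lerD2l -mulrDr -mulr_sumr.
apply: ler_wpM2r; last by nra.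
by rewrite addr_ge0 ?sqr_ge0// mulr_ge0 ?sqr_ge0// sumr_ge0.
Qed.

Lemma residual_le_Xnorm :
  dt * sq <= 2 * (1 + ga ^+ 2) * Xnorm ipH j Vh dt M e ^+ 2.
Proof.
(* The jump terms and the final value are nonnegative and are dropped. *)
rewrite Xnorm_sq -addrA mulrDr -[leLHS]addr0; apply: lerD; last first.
  rewrite mulr_ge0 ?addr_ge0 ?sqr_ge0// ?mulr_ge0 ?addr_ge0 ?sqr_ge0//.
  by rewrite sumr_ge0// => m _; rewrite mulr_ge0 ?sqr_ge0.
rewrite !mulr_sumr big_nat [leRHS]big_nat; apply: ler_sum => m mM.
rewrite -mulrDr [leRHS]mulrCA ler_wpM2l ?(ltW dt_gt0)//.
by apply: residual_step_le; [exact: Vhe|exact: Vhr|exact: rE].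
Qed.

End Trajectory.

End ErrorStep.

(** * Matching initial values and the two-sided bound *)

Lemma eq_of_H_test (R : realType) (V H : completeNormedModType R)
    (ipH : {dot H for idfun}) (j : {linear V -> H}) (S : set V) (x y : V) :
  norm_from_dot ipH -> injective j -> linear_subspace S -> S x -> S y ->
  (forall v, S v -> ipH (j x) (j v) = ipH (j y) (j v)) -> x = y.
Proof.
move=> hH inj hS Sx Sy xy; apply/inj/eqP.
rewrite -subr_eq0 -linearB/= -normr_eq0 -sqrf_eq0 hH {1}linearB linearBl/=.
by rewrite xy ?subrr//; exact: linear_subspaceB.
Qed.

Theorem proposition3p1 (R : realType)
    (p : nat) (hp : (p < 3)%N) (Omega : set 'rV[R]_p.+1)
    (hOmega : bounded_lipschitz_domain Omega)
    (d : nat) (D : set 'rV[R]_d) (hD : tensor_product_domain D)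
    (V H : completeNormedModType R)
    (ipV : {dot V for idfun}) (ipH : {dot H for idfun}) (j : {linear V -> H})
    (hVH : gelfand_triple ipV ipH j)
    (rep : H -> 'rV[R]_p.+1 -> R) (hrep : space_of_functions Omega rep)
    (a : 'rV[R]_d -> {biscalar V})
    (ha_cont : unif_continuous_form D a) (ha_coer : unif_coercive_form D a)
    (f : 'rV[R]_d -> {scalar V}) (hf : unif_bounded_functional D f)
    (T : R) (hT : 0 < T)
    (g : R -> R) (hg : {within `]0, T], continuous g})
    (Q0 : nat) (theta : 'I_Q0 -> 'rV[R]_d -> R) (uq : 'I_Q0 -> H)
    (u0 : 'rV[R]_d -> H)
    (hu0 : forall mu, D mu -> u0 mu = \sum_(q < Q0) theta q mu *: uq q)
    (Vh : set V) (hVh : findim_subspace Vh)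
    (alphaLB gammaUB : 'rV[R]_d -> R) (alpha_lo gamma_up : R)
    (halpha_lo : 0 < alpha_lo)
    (halpha : forall mu, D mu -> alpha_lo <= alphaLB mu <= alpha_h Vh (a mu))
    (hgamma : forall mu, D mu -> gamma_h Vh (a mu) <= gammaUB mu <= gamma_up) :
  forall mu, D mu ->
  exists2 Ce : R, 0 < Ce &
  forall (M : nat) (hM : (0 < M)%N)
    (VN : set V) (hVN : linear_subspace VN) (hVNh : VN `<=` Vh)
    (hproj : forall q, exists2 P, is_H_projection ipH j Vh (uq q) P & VN P)
    (uh uN RN : nat -> V),
  let dt := T / M%:R in
  let eta := estimator dt M (beta_LB (alphaLB mu) (gammaUB mu)) RN in
  let err := Xnorm ipH j Vh dt M (fun m => uh m - uN m) in
  galerkin_solution ipH j dt M Vh (a mu) (f mu) g (u0 mu) uh ->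
  galerkin_solution ipH j dt M VN (a mu) (f mu) g (u0 mu) uN ->
  is_residual_representer ipV ipH j Vh dt M (a mu) (f mu) g uN RN ->
  err <= eta <= Ce * err.

Proof.
have [ipV_norm ipH_norm j_inj j_cont _] := hVH.
move=> mu Dmu.
have [/andP[al_lo al_le] /andP[ga_ge _]] := (halpha _ Dmu, hgamma _ Dmu).
set al := alphaLB mu in al_lo al_le *; set ga := gammaUB mu in ga_ge *.
have al_gt0 : 0 < al := lt_le_trans halpha_lo al_lo.
have Vl := findim_linear_subspace hVh.
have Vh_neq0 : nonzero Vh !=set0.
  (* inf set0 = 0 would contradict alpha_h > 0 *)
  apply/set0P/eqP => Vh0; move: (lt_le_trans al_gt0 al_le).
  by rewrite /alpha_h Vh0 image_set0 inf0 ltxx.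
have b_coer v : Vh v -> al * `|v| ^+ 2 <= a mu v v.
  move=> Vv; have [c _ ac] := ha_coer.
  apply: le_trans (alpha_h_le (ac _ Dmu) Vv).
  by rewrite ler_wpM2r ?sqr_ge0.
have b_cont w v : Vh w -> Vh v -> a mu w v <= ga * `|w| * `|v|.
  move=> Vw Vv; have [c ac] := ha_cont.
  apply: (le_trans (le_gamma_h (ac _ Dmu) Vw Vv)).
  by rewrite -!mulrA ler_wpM2r// mulr_ge0.
(* A nonzero [v] gives [al |v|^2 <= a v v <= ga |v|^2]. *)
have ga_gt0 : 0 < ga.
  have [v [Vv /eqP v0]] := Vh_neq0.
  rewrite -(pmulr_lgt0 _ (_ : 0 < `|v| ^+ 2)) ?exprn_gt0 ?normr_gt0//.
  apply: lt_le_trans (_ : al * `|v| ^+ 2 <= _).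
    by rewrite mulr_gt0// exprn_gt0// normr_gt0.
  by rewrite (le_trans (b_coer _ Vv))// expr2 mulrA b_cont.
set be := beta_LB al ga.
pose ka := Num.min (Num.min (al / ga ^+ 2) al) 1.
pose K := 2 * Num.max (1 / al ^+ 2) 1 + 1.
have ka_gt0 : 0 < ka by rewrite !lt_min al_gt0 ltr01 divr_gt0 ?exprn_gt0.
have K_gt0 : 0 < K.
  by rewrite addr_gt0// mulr_gt0// lt_max ltr01 orbT.
have be2 : be ^+ 2 = ka ^+ 2 / K by rewrite exprMn exprVn sqr_sqrtr ?ltW.
have be2_gt0 : 0 < be ^+ 2 by rewrite be2 divr_gt0 ?exprn_gt0.
(* The factor of [residual_le_Xnorm] over [be^2]; it depends on [mu] only, hence is fixed before [M]
   and [VN]. *)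
pose Ce2 := 2 * (1 + ga ^+ 2) / be ^+ 2.
have Ce2_gt0 : 0 < Ce2.
  by rewrite divr_gt0// mulr_gt0// addr_gt0 ?exprn_gt0.
exists (Num.sqrt Ce2); first by rewrite sqrtr_gt0.
move=> M M_gt0 VN VNl VNh hproj uh uN RN dt eta err.
move=> [uhV uhE uh0] [uNV uNE uN0] hR.
have dt_gt0 : 0 < dt by rewrite divr_gt0// ltr0n.
pose e m := uh m - uN m.
(* Both initial values equal [P0], the [H]-projection of [u0 mu] onto [Vh], which lies in [VN] as a
   combination of the [P q]. *)
have e0 : uh 0 = uN 0.
  pose P q := projT1 (cid2 (hproj q)).
  have hP q : is_H_projection ipH j Vh (uq q) (P q) /\ VN (P q).
    by rewrite /P; case: cid2.
  pose P0 := \sum_(q < Q0) theta q mu *: P q.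
  have VNP0 : VN P0 by apply: linear_subspace_sum => // q; exact: (hP q).2.
  have P0E v : Vh v -> ipH (j P0) (j v) = ipH (u0 mu) (j v).
    move=> Vv; rewrite hu0// linear_sum !linear_sumlz; apply: eq_bigr => q _.
    by rewrite linearZ/= !dotZl (hP q).1.2.
  transitivity P0.
    apply: (eq_of_H_test ipH_norm j_inj Vl); [exact: uhV|exact: VNh|].
    by move=> v Vv; rewrite uh0// P0E.
  symmetry; apply: (eq_of_H_test ipH_norm j_inj VNl); [exact: uNV|by []|].
  by move=> v Vv; rewrite uN0// P0E//; exact: VNh.
have Vhe m : (1 <= m <= M)%N -> Vh (e m).
  move=> /andP[_ mM]; apply: linear_subspaceB => //; first exact: uhV.
  exact/VNh/uNV.
have Vhr m : (1 <= m <= M)%N -> Vh (RN m) by move=> /hR[].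
have rE m : (1 <= m <= M)%N -> forall v, Vh v ->
    ipV (RN m) v = ipH (j (delta dt e m)) (j v) + a mu (e m) v.
  (* The equation for [uh] replaces the data term [g f] of the residual, leaving a difference of the
     two solutions. *)
  move=> mM v Vv; rewrite (hR m mM).2// /residual -(uhE m mM v Vv).
  have -> : delta dt e m = delta dt uh m - delta dt uN m.
    by rewrite /delta -scalerBr /e !opprD !opprK addrACA.
  by rewrite linearB !linearBl/=; ring.
have je0 : j (e 0%N) = 0 by rewrite /e e0 subrr linear0.
have err_le := Xnorm_le_residual ipV_norm ipH_norm j_cont hVh Vh_neq0
  al_gt0 ga_gt0 b_coer b_cont dt_gt0 je0 Vhe rE.
have res_le := residual_le_Xnorm ipV_norm ipH_norm j_cont hVh Vh_neq0
  ga_gt0 b_cont dt_gt0 Vhe Vhr rE.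
rewrite -/err -/ka -/K in err_le res_le.
have err_ge0 : 0 <= err by exact: sqrtr_ge0.
apply/andP; split.
  rewrite -(ger0_norm err_ge0) -sqrtr_sqr; apply: ler_wsqrtr.
  rewrite be2 invf_div mulrA mulrAC ler_pdivlMr ?exprn_gt0// mulrC.
  by rewrite (mulrC dt) -[leRHS]mulrA.
rewrite -[X in _ * X](ger0_norm err_ge0) -sqrtr_sqr -(sqrtrM _ (ltW Ce2_gt0)).
apply: ler_wsqrtr; rewrite -/be /Ce2 mulrAC [leRHS]mulrAC.
by rewrite ler_pM2r ?invr_gt0.
Qed.
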